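(* Let $L$ be a Moufang loop, let $x\in L$, and let $X,Y\subseteq L$. Then $(xX)(Yx)=x(XY)x$. Consequently, if $X$ and $Y$ are finite, then $|(xX)(Yx)|=|XY|$. If, in addition, $L$ is commutative, then $(xX)(xY)=x(XY)x$, and hence (for finite $X,Y$) $|(xX)(xY)|=|XY|$.
   Context: A loop is a set with a binary operation having a two-sided identity $1$ such that for all $a,b$ the equations $ax=b$ and $ya=b$ have unique solutions. A Moufang loop is a loop satisfying $(xy)(zx)=(x(yz))x$ for all $x,y,z$; it is commutative if $xy=yx$ for all $x,y$. For subsets $X,Y$ of a loop, $XY=\{xy:x\in X,y\in Y\}$; $xX=\{xu:u\in X\}$, $Yx=\{vx:v\in Y\}$, and $xSx=\{xtx:t\in S\}$, where $xtx:=(xt)x=x(tx)$ is well defined in a Moufang loop. *)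

(* Defs.v *)
From HB Require Import structures.
From mathcomp Require Import all_boot.
From mathcomp Require Import boolp classical_sets functions cardinality.

Set Implicit Arguments.
Unset Strict Implicit.
Unset Printing Implicit Defensive.

Local Open Scope classical_set_scope.
Local Open Scope group_scope.

(* The multiplication and the two-sided identity come from umagmaType. *)
HB.mixin Record UMagma_isLoop L of UMagma L := {
  ldiv_uniq : forall a b : L, exists! x : L, a * x = b;
  rdiv_uniq : forall a b : L, exists! y : L, y * a = b
}.

#[short(type="loopType")]
HB.structure Definition Loop := {L of UMagma_isLoop L & UMagma L}.

HB.mixin Record Loop_isMoufang L of Loop L := {
  moufang : forall x y z : L, (x * y) * (z * x) = (x * (y * z)) * x
}.

#[short(type="moufangLoopType")]
HB.structure Definition MoufangLoop := {L of Loop_isMoufang L & Loop L}.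

Section SetProducts.
Variable L : moufangLoopType.
Implicit Types (x u v t : L) (X Y S : set L).

(* Hence [x t x] may be bracketed either way in [sandwich] below. *)
Lemma moufang_flexible x t : (x * t) * x = x * (t * x).
Proof. by have := moufang x 1 t; rewrite mulg1 mul1g. Qed.

Definition set_mul X Y : set L := [set u * v | u in X & v in Y].
Definition lset_mul x X : set L := [set x * u | u in X].
Definition rset_mul Y x : set L := [set v * x | v in Y].
Definition sandwich x S : set L := [set (x * t) * x | t in S].

End SetProducts.

(* Main.v *)
Require Import Defs.
From mathcomp Require Import all_boot.
From mathcomp Require Import boolp classical_sets functions cardinality.

Local Open Scope classical_set_scope.
Local Open Scope card_scope.
Local Open Scope group_scope.

(** The Moufang identity [(x * u) * (v * x) = (x * (u * v)) * x], applied to each pair [u], [v] from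
    [X] and [Y], is the set identity ([set_mul_sandwich]). Since translations of a loop are
    injective, so is [t] ↦ [(x * t) * x], and sandwiching preserves cardinality ([card_sandwich]).
    Commutativity identifies [xY] with [Yx], which reduces the last part to the first two. *)

Lemma loop_mulgI (L : loopType) (a : L) : injective (fun u : L => a * u).
Proof.
move=> u v /= Euv; have [w [_ uniq_w]] := ldiv_uniq a (a * v).
by rewrite -(uniq_w u Euv) -(uniq_w v erefl).
Qed.

Lemma loop_mulIg (L : loopType) (a : L) : injective (fun u : L => u * a).
Proof.
move=> u v /= Euv; have [w [_ uniq_w]] := rdiv_uniq a (v * a).
by rewrite -(uniq_w u Euv) -(uniq_w v erefl).
Qed.

(** The map [t] ↦ [(x * t) * x] is left translation by [x] followed by right translation by [x];
    cancelling the outer [x] and then the inner one shows it injective. *)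
Lemma card_sandwich (L : moufangLoopType) (x : L) (S : set L) :
  sandwich x S #= S.
Proof.
apply: inj_card_eq => u v _ _ Euv.
exact: (@loop_mulgI L x _ _ (@loop_mulIg L x _ _ Euv)).
Qed.

Lemma set_mul_sandwich (L : moufangLoopType) (x : L) (X Y : set L) :
  set_mul (lset_mul x X) (rset_mul Y x) = sandwich x (set_mul X Y).
Proof.
apply/seteqP; split=> [_ [_ [u Xu <-] [_ [v Yv <-] <-]]|_ [_ [u Xu [v Yv <-]] <-]].
- by rewrite moufang; exists (u * v) => //; exists u => //; exists v.
- rewrite -moufang; exists (x * u); first by exists u.
  by exists (v * x) => //; exists v.
Qed.

Theorem proposition3p5 (L : moufangLoopType) (x : L) (X Y : set L) :
  [/\ set_mul (lset_mul x X) (rset_mul Y x) = sandwich x (set_mul X Y),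
      finite_set X -> finite_set Y ->
        set_mul (lset_mul x X) (rset_mul Y x) #= set_mul X Y
    & (forall u v : L, u * v = v * u) ->
        set_mul (lset_mul x X) (lset_mul x Y) = sandwich x (set_mul X Y) /\
        (finite_set X -> finite_set Y ->
           set_mul (lset_mul x X) (lset_mul x Y) #= set_mul X Y)].
Proof.
split=> [|_ _|mulC]; first exact: set_mul_sandwich.
  by rewrite set_mul_sandwich; apply: card_sandwich.
(* The two sets are images of [Y] under maps that agree pointwise by commutativity. *)
have -> : lset_mul x Y = rset_mul Y x by apply: eq_imagel => v _; apply: mulC.
by rewrite set_mul_sandwich; split=> // _ _; apply: card_sandwich.
Qed.
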